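(* Let $A_i(\varepsilon)=A_i+\varepsilon\Delta^{(i)}\in\mathbb C^{d\times d}$, $i=1,\dots,m$, $\varepsilon\in\mathbb R$, with $\|\Delta^{(i)}\|_F=1$ and each $A_i$ having simple nonzero eigenvalues $\lambda_1^{(i)},\dots,\lambda_d^{(i)}$, and let $p_1,\dots,p_m$ be probability weights. Assume simultaneous triangularizability: there exist $\varepsilon_0>0$ and invertible matrices $S(\varepsilon)$, $|\varepsilon|\le\varepsilon_0$, such that $T_i(\varepsilon):=S(\varepsilon)^{-1}A_i(\varepsilon)S(\varepsilon)$ is upper triangular for all $i$, with diagonal entries $\lambda_j^{(i)}(\varepsilon):=(T_i(\varepsilon))_{jj}\ne0$, ordered so that $\lambda_j^{(i)}(0)=\lambda_j^{(i)}$ and labelled so as to agree with the analytic eigenvalue branches of $A_i(\varepsilon)$ issuing from $\lambda_j^{(i)}$. Let $\mu_j(\varepsilon):=\sum_ip_i\log|\lambda_j^{(i)}(\varepsilon)|$ and $\rho_\infty(\varepsilon):=\max_{1\le j\le d}e^{\mu_j(\varepsilon)}$. Assume there is an index $j^\star$ with $\mu_{j^\star}(0)>\max_{j\ne j^\star}\mu_j(0)$. Then, for $|\varepsilon|$ sufficiently small, $$\sigma_\infty^2(\varepsilon)=\rho_\infty(\varepsilon)^2\operatorname{Var}_{\boldsymbol p}\bigl(\log|\lambda_{j^\star}^{(i)}(\varepsilon)|\bigr),$$ and, in particular, $\sigma_\infty(\varepsilon)=\sigma_\infty(0)+O(\varepsilon)$ as $\varepsilon\to0$.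
   Context: $p_i\ge0$, $\sum_ip_i=1$. $\operatorname{Var}_{\boldsymbol p}(x_i):=\sum_ip_ix_i^2-(\sum_ip_ix_i)^2$. Whenever the maximum of $\mu_j(\varepsilon)$ over $j$ is attained at a unique index $j^\star(\varepsilon)$, $\sigma_\infty(\varepsilon):=\rho_\infty(\varepsilon)\bigl(\sum_{i}p_i(\log|\lambda_{j^\star(\varepsilon)}^{(i)}(\varepsilon)|)^2-\mu_{j^\star(\varepsilon)}(\varepsilon)^2\bigr)^{1/2}$. $\|\cdot\|_F$ is the Frobenius norm. *)

(* Defs.v *)
(* MathComp / MathComp-Analysis world; R[i] = complex R, from mathcomp-real-closed. *)
From HB Require Import structures.
From mathcomp Require Import all_boot all_order all_algebra.
From mathcomp Require Import complex.
From mathcomp Require Import all_classical all_reals all_analysis.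

Set Implicit Arguments.
Unset Strict Implicit.
Unset Printing Implicit Defensive.

Import Order.TTheory GRing.Theory Num.Theory.
Import numFieldNormedType.Exports.

Local Open Scope classical_set_scope.
Local Open Scope ring_scope.
Local Open Scope complex_scope.

Section Matrices.
Variables (R : realType) (d : nat).
Implicit Types (A D T : 'M[R[i]]_d).

(* [ComplexField.Normc.normc] is the modulus with values in R; [`|z|] would be in R[i]. *)
Definition frobenius_norm A : R :=
  Num.sqrt (\sum_i \sum_j ComplexField.Normc.normc (A i j) ^+ 2).

(* l lists the eigenvalues of A with algebraic multiplicity, and each of them
   is simple. *)
Definition simple_spectrum A (l : 'I_d -> R[i]) : Prop :=
  char_poly A = \prod_j ('X - (l j)%:P) /\
  forall j, mup (l j) (char_poly A) = 1%N.

(* [is_trig_mx] of the library means lower triangular. *)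
Definition upper_triangular T : bool := is_trig_mx T^T.

Definition perturbed A D (e : R) : 'M[R[i]]_d := A + e%:C *: D.

(* Complex-valued real-analyticity at 0; [R[i]^o] carries the usual topology
   of the complex plane. *)
Definition analytic_at0 (f : R -> R[i]) : Prop :=
  exists c : nat -> R[i], \forall e \near (0 : R),
    series (fun n => c n * e%:C ^+ n) @ \oo --> (f e : R[i]^o).

Definition analytic_eigenvalue_branch A D (l : R[i]) (b : R -> R[i]) : Prop :=
  [/\ analytic_at0 b, b 0 = l &
      \forall e \near (0 : R), eigenvalue (perturbed A D e) (b e)].

(* S(e) matters only where it is invertible. *)
Definition conjugated A D (S : R -> 'M[R[i]]_d) (e : R) : 'M[R[i]]_d :=
  invmx (S e) *m perturbed A D e *m S e.

End Matrices.

Section Growth.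
Variables (R : realType) (m d : nat) (p : 'I_m -> R).

Definition Var (x : 'I_m -> R) : R :=
  \sum_i p i * x i ^+ 2 - (\sum_i p i * x i) ^+ 2.

Variable lam : 'I_m -> 'I_d -> R -> R[i].

Definition log_modulus (i : 'I_m) (j : 'I_d) (e : R) : R :=
  ln (ComplexField.Normc.normc (lam i j e)).

Definition mu (j : 'I_d) (e : R) : R := \sum_i p i * log_modulus i j e.

(* The default value 0 of the maximum is harmless, exponentials being positive. *)
Definition rho_infty (e : R) : R := \big[Num.max/0]_(j < d) expR (mu j e).

Definition unique_argmax (e : R) (j : 'I_d) : bool :=
  [forall k, (k != j) ==> (mu k e < mu j e)].

(* At most one j satisfies [unique_argmax e j], so [pick] involves no choice;
   when there is none, sigma_infty is undefined and 0 is a junk value. *)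
Definition sigma_infty (e : R) : R :=
  if [pick j | unique_argmax e j] is Some j then
    rho_infty e *
      Num.sqrt (\sum_i p i * log_modulus i j e ^+ 2 - mu j e ^+ 2)
  else 0.

End Growth.

(* Main.v *)
(** Near 0 the triangular diagonal entries agree with convergent power series,
    which are Lipschitz at 0; hence so are the log-moduli, the logarithm being
    differentiable at the nonzero moduli, and the exponents [mu].  By continuity
    the strict maximum at [jstar] persists, so that [sigma_infty] is
    [expR (mu jstar)] times the standard deviation of the log-moduli.  The square
    root of the variance may vanish at 0, where [sqrt] is not Lipschitz; instead,
    the standard deviation is a seminorm bounded by the sup norm, and therefore a
    Lipschitz function of the log-moduli. *)

Require Import Defs.
From HB Require Import structures.
From mathcomp Require Import all_boot all_order all_algebra.
From mathcomp Require Import complex.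
From mathcomp Require Import all_classical all_reals all_analysis.
From mathcomp Require Import ring lra.
Import Order.TTheory GRing.Theory Num.Theory.
Import numFieldNormedType.Exports.
Local Open Scope classical_set_scope.
Local Open Scope ring_scope.
Local Open Scope complex_scope.

(** * Power series near their centre *)

Lemma geometric_half_le2 (K : numFieldType) (n : nat) :
  \sum_(k < n) (2^-1 : K) ^+ k <= 2.
Proof.
suff -> : \sum_(k < n) (2^-1 : K) ^+ k = 2 - 2 * 2^-1 ^+ n.
  by rewrite gerBl mulr_ge0 // exprn_ge0 // invr_ge0.
elim: n => [|n IH]; first by rewrite big_ord0 expr0 mulr1 subrr.
by rewrite big_ord_recr /= IH exprS; field.
Qed.

(** Convergence at [z0] bounds all terms there by some [M]. For [z] at most half as large, the
    [n]-th term is at most [M (|z|/|z0|)^n]; keeping one factor [|z|/|z0|] and bounding the others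
    by 1/2 leaves a geometric sum, at most 2. *)
Lemma power_series_near0 (K : numFieldType) (c : nat -> K) (z0 : K) :
  z0 != 0 -> cvgn (series (fun n => c n * z0 ^+ n) : nat -> K^o) ->
  exists2 C : K, 0 <= C & forall z l : K, `|z| <= `|z0| / 2 ->
    (series (fun n => c n * z ^+ n) : nat -> K^o) @ \oo --> (l : K^o) ->
    `|l - c 0%N| <= C * `|z|.
Proof.
move=> z0N0 /cvg_series_cvg_0 cv0.
have [M M0 cM] : exists2 M : K, 0 < M & forall n, `|c n * z0 ^+ n| <= M.
  have /pinfty_ex_gt0[M M0 h] : bounded_fun (fun n => c n * z0 ^+ n : K^o).
    by apply: cvg_seq_bounded; apply/cvg_ex; exists 0.
  by exists M => // n; exact: h.
have z0p : 0 < `|z0| by rewrite normr_gt0.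
exists (2 * M / `|z0|); first by rewrite mulr_ge0 ?invr_ge0 // mulr_ge0 // ltW.
move=> z l zz0 cvl.
have part n : `|series (fun n => c n * z ^+ n) n.+1 - c 0%N|
              <= 2 * M / `|z0| * `|z|.
  rewrite /series /= big_mkord big_ord_recl expr0 mulr1 addrAC subrr add0r.
  apply: (le_trans (ler_norm_sum _ _ _)).
  have -> : 2 * M / `|z0| * `|z| = M * (`|z| / `|z0|) * 2.
    by rewrite mulrC; field; rewrite gt_eqF.
  apply: (@le_trans _ _ (\sum_(k < n) M * (`|z| / `|z0|) * 2^-1 ^+ k)).
    apply: ler_sum => k _; rewrite lift0.
    have -> : c k.+1 * z ^+ k.+1 = c k.+1 * z0 ^+ k.+1 * (z / z0) ^+ k.+1.
      by rewrite expr_div_n mulrA [c _ * _ * _]mulrAC mulfK // expf_neq0.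
    rewrite normrM normrX normf_div [X in _ * X]exprS mulrA.
    apply: ler_pM.
    - by rewrite mulr_ge0 // divr_ge0.
    - by rewrite exprn_ge0 // divr_ge0.
    - by rewrite ler_wpM2r ?divr_ge0.
    - by apply: lerXn2r; rewrite ?nnegrE ?divr_ge0 // ler_pdivrMr // mulrC.
  by rewrite -mulr_sumr ler_wpM2l ?geometric_half_le2 // mulr_ge0 ?divr_ge0 // ltW.
apply/ler_addgt0Pl => e e0.
(* The index is [N.+1] because [part] bounds only partial sums that contain the constant term. *)
have /cvgrPdist_lt /(_ e e0) [N _ /(_ N.+1 (leqnSn N)) Nl] := cvl.
rewrite -[l](subrK (series (fun n => c n * z ^+ n) N.+1)) -addrA.
by apply: (le_trans (ler_normD _ _)); apply: lerD; [exact: ltW|exact: part].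
Qed.

(** * Calculus of functions Lipschitz at a point *)

Section LipschitzAt.
Context {R : realType}.
Implicit Types (f g : R -> R) (a e : R).

(** One of the two points is fixed at [a]: this is weaker than being Lipschitz near [a], and is the
    form of the final O-estimate. *)
Definition lipschitz_at a f : Prop :=
  exists2 C : R, 0 <= C & \forall e \near a, `|f e - f a| <= C * `|e - a|.

Lemma lipschitz_at_continuous {a f} : lipschitz_at a f -> f @ a --> f a.
Proof.
move=> [C C0 fC]; apply/cvgrPdist_lt => e e0.
near=> x; rewrite distrC.
apply: (@le_lt_trans _ _ (C * `|x - a|)); first by near: x.
apply: (@le_lt_trans _ _ ((C + 1) * `|x - a|)).
  by rewrite ler_wpM2r // lerDl.
rewrite mulrC -ltr_pdivlMr ?ltr_wpDl // distrC.
near: x; apply: cvgr_dist_lt; first exact: cvg_id.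
by rewrite divr_gt0 // ltr_wpDl.
Unshelve. all: by end_near. Qed.

Lemma lipschitz_at_comp {a f g} :
  lipschitz_at a f -> lipschitz_at (f a) g -> lipschitz_at a (g \o f).
Proof.
move=> fL [D D0 gD]; have fc := lipschitz_at_continuous fL.
have [C C0 fC] := fL.
exists (D * C); first exact: mulr_ge0.
have := fc _ gD; rewrite /= near_simpl; apply: filterS2 fC => x fC gD'.
by rewrite (le_trans gD') // -mulrA ler_wpM2l.
Qed.

Lemma lipschitz_at_uniform (I : finType) {F : I -> R -> R} {a} :
  (forall i, lipschitz_at a (F i)) ->
  exists2 C : R, 0 <= C &
    \forall e \near a, forall i, `|F i e - F i a| <= C * `|e - a|.
Proof.
move=> FL.
have /choice[C CP] i : exists c, 0 <= c /\
    \forall e \near a, `|F i e - F i a| <= c * `|e - a|.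
  by have [c c0 h] := FL i; exists c.
have C0 i : 0 <= C i by case: (CP i).
exists (\sum_i C i); first exact: sumr_ge0.
pose P i e := `|F i e - F i a| <= (\sum_i C i) * `|e - a|.
apply: (@filter_forall _ _ P (nbhs a) (nbhs_filter a)) => i.
apply: filterS (CP i).2 => e /le_trans; apply.
by rewrite ler_wpM2r // (bigD1 i) //= lerDl sumr_ge0.
Qed.

Lemma lipschitz_at_sum (I : finType) (w : I -> R) {F : I -> R -> R} {a} :
  (forall i, lipschitz_at a (F i)) ->
  lipschitz_at a (fun e => \sum_i w i * F i e).
Proof.
move=> /lipschitz_at_uniform[C C0 FC].
exists ((\sum_i `|w i|) * C); first by rewrite mulr_ge0 ?sumr_ge0.
apply: filterS FC => e FC; rewrite -sumrB -mulrA mulr_suml.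
apply: (le_trans (ler_norm_sum _ _ _)); apply: ler_sum => i _.
by rewrite -mulrBr normrM ler_wpM2l.
Qed.

Lemma lipschitz_at_mul {a f g} :
  lipschitz_at a f -> lipschitz_at a g -> lipschitz_at a (fun e => f e * g e).
Proof.
move=> fL [D D0 gD]; have fc := lipschitz_at_continuous fL.
have [C C0 fC] := fL.
(* By continuity [|f x|] is at most [|f a| + 1] near [a]. *)
exists ((`|f a| + 1) * D + C * `|g a|).
  by rewrite addr_ge0 // mulr_ge0 // addr_ge0.
near=> x.
have -> : f x * g x - f a * g a = f x * (g x - g a) + (f x - f a) * g a.
  by ring.
apply: (le_trans (ler_normD _ _)); rewrite !normrM mulrDl; apply: lerD.
  rewrite -mulrA ler_pM //; last by near: x.
  rewrite -[f x](subrK (f a)) addrC (le_trans (ler_normD _ _)) // lerD2l.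
  by rewrite distrC ltW //; near: x; exact: cvgr_dist_lt.
by rewrite [leRHS]mulrAC ler_wpM2r //; near: x.
Unshelve. all: by end_near. Qed.

(** The difference quotient converges, so it is bounded near [a]. *)
Lemma derivable_lipschitz_at {a f} : derivable f a 1 -> lipschitz_at a f.
Proof.
move=> /cvg_ex[l /cvg_bounded /pinfty_ex_gt0 [M M0]].
move=> fM; exists M; first exact: ltW.
rewrite (near_shift (0 : R)) subr0 /=.
rewrite /= /dnbhs /within /= in fM.
near=> h; rewrite /= addrK.
have hM : h != 0 -> `|h^-1 * (f (h * 1 + a) - f a)| <= M by near: h.
(* The quotient is bounded only on a punctured neighbourhood, so a zero increment is treated
   apart. *)
have [->|h0] := eqVneq h 0; first by rewrite add0r !subrr !normr0 mulr0.
by have := hM h0; rewrite normrM normfV ler_pdivrMl ?normr_gt0// mulr1 mulrC.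
Unshelve. all: by end_near. Qed.

End LipschitzAt.

(** * Real-valued moduli of analytic functions *)

Lemma normcE (R : realType) (z : R[i]) : `|z| = (Normc.normc z)%:C.
Proof. by case: z. Qed.

Lemma normc_real (R : realType) (r : R) : Normc.normc r%:C = `|r|.
Proof. by rewrite /= expr0n addr0 sqrtr_sqr. Qed.

Lemma ler_dist_normc (R : realType) (x y : R[i]) :
  `|Normc.normc x - Normc.normc y| <= Normc.normc (x - y).
Proof.
rewrite -lecR -!normcE.
have -> : (`|Normc.normc x - Normc.normc y|)%:C = `| `|x| - `|y| |.
  by rewrite -normc_real -normcE rmorphB /= -!normcE.
exact: ler_dist_dist.
Qed.

Lemma analytic_at0_normc_lipschitz (R : realType) (b : R -> R[i]) :
  analytic_at0 b -> lipschitz_at 0 (fun e => Normc.normc (b e)).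
Proof.
move=> [c cb].
have [r /= r0 rb] : exists2 r : R, 0 < r & forall e, `|e| < r ->
    (series (fun n => c n * e%:C ^+ n) : nat -> R[i]^o) @ \oo --> (b e : R[i]^o).
  have [r /= r0 rb] := cb; exists r => // e er.
  by apply: rb; rewrite /= sub0r normrN.
(* The nonzero real point [r / 2], where the series converges, plays the role of [z0]. *)
have z0N0 : (r / 2)%:C != 0 :> R[i].
  by rewrite (fmorph_eq0 (real_complex R)) gt_eqF // divr_gt0.
have r2 : `|r / 2| < r.
  by rewrite gtr0_norm ?divr_gt0 // ltr_pdivrMr // ltr_pMr // ltr1n.
have [|C C0 CP] := @power_series_near0 _ c _ z0N0.
  by apply/cvg_ex; exists (b (r / 2)); exact: rb.
(* At [z = 0] the linear bound vanishes and forces equality. *)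
have b0 : b 0 = c 0%N.
  have := CP 0 (b 0).
  rewrite !normr0 mulr0 divr_ge0 // => /(_ isT).
  have := rb 0; rewrite normr0 => /(_ r0) h /(_ h).
  by rewrite normr_le0 subr_eq0 => /eqP.
exists (Normc.normc C) => [|]; first by case: (C) => *; exact: sqrtr_ge0.
near=> e; rewrite subr0.
apply: (le_trans (ler_dist_normc _ _ _)).
rewrite -lecR rmorphM /= -!normcE (ger0_norm C0) b0.
have -> : (`|e|)%:C = `|e%:C| :> R[i].
  by rewrite normcE normc_real.
apply: CP; last first.
  by apply: rb; near: e; exact: (@nbhs0_lt _ R^o).
rewrite !normcE !normc_real ler_pdivlMr // -[2](rmorph_nat (real_complex R)).
rewrite -rmorphM lecR -ler_pdivlMr //.
by near: e; apply: (@nbhs0_le _ R^o); rewrite divr_gt0 // normr_gt0 gt_eqF // divr_gt0.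
Unshelve. all: by end_near. Qed.

(** * The standard deviation as a seminorm *)

Section Variance.
Context {R : realType} {m : nat} {p : 'I_m -> R}.
Hypotheses (p0 : forall i, 0 <= p i) (p1 : \sum_i p i = 1).
Implicit Types x y : 'I_m -> R.

Definition Cov x y : R :=
  \sum_i p i * (x i * y i) - (\sum_i p i * x i) * (\sum_i p i * y i).

Lemma Var_lincomb x y s t :
  Var p (fun i => s * x i + t * y i) =
  s ^+ 2 * Var p x + 2 * s * t * Cov x y + t ^+ 2 * Var p y.
Proof.
rewrite /Var /Cov.
have -> : \sum_i p i * (s * x i + t * y i) =
    s * (\sum_i p i * x i) + t * (\sum_i p i * y i).
  by rewrite !mulr_sumr -big_split; apply: eq_bigr => i _ /=; ring.
have -> : \sum_i p i * (s * x i + t * y i) ^+ 2 =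
    s ^+ 2 * (\sum_i p i * x i ^+ 2) + 2 * s * t * (\sum_i p i * (x i * y i))
    + t ^+ 2 * (\sum_i p i * y i ^+ 2).
  by rewrite !mulr_sumr -!big_split; apply: eq_bigr => i _ /=; ring.
ring.
Qed.

Lemma Var_ge0 x : 0 <= Var p x.
Proof.
set M := \sum_i p i * x i.
(* Centring at the mean gives a sum of squares; the two forms agree because the weights sum to 1. *)
have -> : Var p x = \sum_i p i * (x i - M) ^+ 2.
  have -> : \sum_i p i * (x i - M) ^+ 2 =
      \sum_i p i * x i ^+ 2 - 2 * M * M + (\sum_i p i) * M ^+ 2.
    rewrite {3}/M mulr_sumr mulr_suml -sumrB -big_split.
    by apply: eq_bigr => i _ /=; ring.
  by rewrite p1 /Var -/M; ring.
by apply: sumr_ge0 => i _; rewrite mulr_ge0 // sqr_ge0.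
Qed.

Lemma Cov_le x y : Cov x y <= Num.sqrt (Var p x) * Num.sqrt (Var p y).
Proof.
(* The quadratic polynomial [Var (t x + y)] in [t] is nonnegative. *)
have Q t : 0 <= t ^+ 2 * Var p x + 2 * t * Cov x y + Var p y.
  have := Var_ge0 (fun i => t * x i + 1 * y i).
  by rewrite Var_lincomb expr1n mulr1 mul1r.
rewrite -sqrtrM ?Var_ge0 // (le_trans (ler_norm _)) // -sqrtr_sqr ler_wsqrtr //.
have x0 := Var_ge0 x; have [xz|xN0] := eqVneq (Var p x) 0.
  rewrite xz mul0r.
  have [->|cN0] := eqVneq (Cov x y) 0; first by rewrite expr0n.
  (* Without its quadratic term the polynomial is affine in [t]; this [t] would give it the value
     -1. *)
  have := Q (- (Var p y + 1) / (2 * Cov x y)); rewrite xz.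
  have -> : (- (Var p y + 1) / (2 * Cov x y)) ^+ 2 * 0 +
    2 * (- (Var p y + 1) / (2 * Cov x y)) * Cov x y + Var p y = -1 by field.
  by rewrite lerNr oppr0 ler10.
have xp : 0 < Var p x by rewrite lt_neqAle eq_sym xN0.
(* This [t] is the minimiser of the quadratic. *)
have := Q (- Cov x y / Var p x).
have -> : (- Cov x y / Var p x) ^+ 2 * Var p x +
  2 * (- Cov x y / Var p x) * Cov x y + Var p y =
  (Var p x * Var p y - Cov x y ^+ 2) / Var p x by field.
by rewrite pmulr_lge0 ?invr_gt0 // subr_ge0.
Qed.

(** This is the reverse triangle inequality for the seminorm; after squaring and expanding it
    reduces to the Cauchy-Schwarz bound [Cov_le]. *)
Lemma ler_dist_sd x y :
  `|Num.sqrt (Var p x) - Num.sqrt (Var p y)|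
  <= Num.sqrt (Var p (fun i => x i - y i)).
Proof.
rewrite -sqrtr_sqr ler_wsqrtr //.
have -> : Var p (fun i => x i - y i) = Var p x - 2 * Cov x y + Var p y.
  have := Var_lincomb x y 1 (-1).
  have -> : (fun i => 1 * x i + -1 * y i) = (fun i => x i - y i).
    by apply/funext => i; rewrite mul1r mulN1r.
  by move=> ->; ring.
rewrite sqrrB !sqr_sqrtr ?Var_ge0 // mulr2n.
by have := Cov_le x y; lra.
Qed.

(** Dropping the squared mean leaves a weighted average of squares, each at most [C ^+ 2]. *)
Lemma sd_le (C : R) x :
  0 <= C -> (forall i, `|x i| <= C) -> Num.sqrt (Var p x) <= C.
Proof.
move=> C0 xC; rewrite -[leRHS]ger0_norm // -sqrtr_sqr ler_wsqrtr // /Var.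
apply: (@le_trans _ _ (\sum_i p i * x i ^+ 2)).
  by rewrite gerBl sqr_ge0.
rewrite -[leRHS]mul1r -p1 mulr_suml; apply: ler_sum => i _.
by rewrite ler_wpM2l // -[x i ^+ 2]real_normK ?num_real // lerXn2r // nnegrE.
Qed.

Lemma lipschitz_at_sd (F : 'I_m -> R -> R) a :
  (forall i, lipschitz_at a (F i)) ->
  lipschitz_at a (fun e => Num.sqrt (Var p (F ^~ e))).
Proof.
move=> /lipschitz_at_uniform[C C0 FC]; exists C => //.
apply: filterS FC => e FC; apply: (le_trans (ler_dist_sd _ _)).
by apply: sd_le => //; rewrite mulr_ge0.
Qed.

End Variance.

(** * Growth rate and deviation at a unique maximiser *)

Section UniqueArgmax.
Context {R : realType} {m d : nat} {p : 'I_m -> R}.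
Context {lam : 'I_m -> 'I_d -> R -> R[i]} {e : R} {j : 'I_d}.
Hypothesis uj : unique_argmax p lam e j.

Lemma rho_infty_unique_argmax : rho_infty p lam e = expR (mu p lam j e).
Proof.
apply/eqP; rewrite eq_le /rho_infty; apply/andP; split; last first.
  exact: (le_bigmax _ (fun k => expR (mu p lam k e))).
apply: bigmax_le => [|k _]; first exact: expR_ge0.
have [->//|kj] := eqVneq k j.
by rewrite ler_expR ltW // (implyP (forallP uj k)).
Qed.

Lemma sigma_infty_unique_argmax :
  sigma_infty p lam e =
  expR (mu p lam j e) * Num.sqrt (Var p (fun i => log_modulus lam i j e)).
Proof.
rewrite /sigma_infty; case: pickP => [k uk|/(_ j)]; last by rewrite uj.
have [->|kj] := eqVneq k j; first by rewrite rho_infty_unique_argmax.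
(* Two distinct unique maximisers would each strictly exceed the other. *)
have := implyP (forallP uj k) kj; rewrite eq_sym in kj.
by move=> /lt_trans/(_ (implyP (forallP uk j) kj)); rewrite ltxx.
Qed.

End UniqueArgmax.

Theorem corollary6 (R : realType) (m d : nat)
    (A Delta : 'I_m -> 'M[R[i]]_d) (lambda : 'I_m -> 'I_d -> R[i])
    (p : 'I_m -> R) (eps0 : R) (S : R -> 'M[R[i]]_d) (jstar : 'I_d) :
  let T (i : 'I_m) (e : R) : 'M[R[i]]_d := conjugated (A i) (Delta i) S e in
  let lam (i : 'I_m) (j : 'I_d) (e : R) : R[i] := T i e j j in
  (forall i, frobenius_norm (Delta i) = 1) ->
  (forall i, simple_spectrum (A i) (lambda i)) ->
  (forall i j, lambda i j != 0) ->
  (forall i, 0 <= p i) ->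
  \sum_i p i = 1 ->
  0 < eps0 ->
  (forall e, `|e| <= eps0 -> S e \in unitmx) ->
  (forall i e, `|e| <= eps0 -> upper_triangular (T i e)) ->
  (forall i j e, `|e| <= eps0 -> lam i j e != 0) ->
  (forall i j, lam i j 0 = lambda i j) ->
  (forall i j, exists b : R -> R[i],
     analytic_eigenvalue_branch (A i) (Delta i) (lambda i j) b /\
     \forall e \near (0 : R), lam i j e = b e) ->
  (forall j, j != jstar -> mu p lam j 0 < mu p lam jstar 0) ->
  (\forall e \near (0 : R),
     unique_argmax p lam e jstar /\
     sigma_infty p lam e ^+ 2 =
       rho_infty p lam e ^+ 2 * Var p (fun i => log_modulus lam i jstar e)) /\
  (fun e : R => sigma_infty p lam e - sigma_infty p lam 0) =O_ (0 : R) id.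
Proof.
move=> T lam _ _ lambda0 p0 p1 _ _ _ _ lam0 branch gap.
have logL i j : lipschitz_at 0 (log_modulus lam i j).
  have [b [[ab b0 _] lamb]] := branch i j.
  have normL : lipschitz_at 0 (fun e => Normc.normc (lam i j e)).
    have [C C0 bC] := @analytic_at0_normc_lipschitz R b ab.
    exists C => //; apply: filterS2 lamb bC => e -> bC.
    by rewrite lam0 -b0.
  apply: (@lipschitz_at_comp _ 0 _ (@ln R) normL); apply: derivable_lipschitz_at.
  have pos : 0 < Normc.normc (lam i j 0).
    by rewrite -ltcR -normcE normr_gt0 lam0.
  exact: (@ex_derive _ _ _ _ _ _ _ (is_derive1_ln pos)).
have muL j : lipschitz_at 0 (mu p lam j) by exact: lipschitz_at_sum.
have unique0 : unique_argmax p lam 0 jstar.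
  by apply/forallP => k; apply/implyP; exact: gap.
have unique : \forall e \near (0 : R), unique_argmax p lam e jstar.
  pose P k e := (k != jstar) ==> (mu p lam k e < mu p lam jstar e).
  suff : \forall e \near (0 : R), forall k, P k e by apply: filterS => e /forallP.
  apply: (@filter_forall _ _ P (nbhs (0 : R)) (nbhs_filter (0 : R))) => k.
  rewrite /P.
  (* The midpoint of the two exponents at 0 still separates them near 0, by continuity. *)
  have [_|/gap/midf_lt[/= lo hi]] := eqVneq k jstar; first exact: nearW.
  have kc := lipschitz_at_continuous (muL k).
  have jc := lipschitz_at_continuous (muL jstar).
  apply: filterS2 (cvgr_lt _ kc _ lo) (cvgr_gt _ jc _ hi) => e.
  exact: lt_trans.
split.
  apply: filterS unique => e ue; split=> //.
  rewrite (sigma_infty_unique_argmax ue) (rho_infty_unique_argmax ue) exprMn.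
  by rewrite sqr_sqrtr ?Var_ge0.
have [C C0 sC] : lipschitz_at 0 (fun e => expR (mu p lam jstar e) *
    Num.sqrt (Var p (fun i => log_modulus lam i jstar e))).
  apply: lipschitz_at_mul; last exact: lipschitz_at_sd.
  apply: (@lipschitz_at_comp _ 0 _ expR (muL jstar)).
  exact/derivable_lipschitz_at/derivable_expR.
(* The O-constant must be positive, while [C] may be 0. *)
apply/eqO_exP; exists (C + 1); first by rewrite ltr_wpDl.
apply: filterS2 unique sC => e ue.
rewrite (sigma_infty_unique_argmax ue) (sigma_infty_unique_argmax unique0) subr0.
by move=> /le_trans; apply; rewrite ler_wpM2r // lerDl.
Qed.
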